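(* Let $k\in[0,1)$ and $\lambda\in[0,1]$ satisfy $(1-\lambda^2)k^2/(1-k^2)<1$ (Region II; for $k>0$ equivalently $\lambda^2>2-1/k^2$), let $\nu>-1$ be real with \[ \frac{(1-\lambda^2)|\nu|}{\nu+1}<1, \] and let $N$ be a positive integer. Then \[ \Pi(\lambda,\nu,k)=\Pi(\nu,k)-\sqrt{\frac{1-\lambda^2}{1-k^2}}\sum_{m=0}^{N-1}\frac{(1-\lambda^2)^{m}}{2m+1}\sum_{n=0}^{m}\frac{\nu^{m-n}\,{}_2F_1\!\left(-n,\tfrac12;1;(1-k^2)^{-1}\right)}{(1+\nu)^{m-n+1}}+R_{2,N}(k,\nu,\lambda), \] where \[ |R_{2,N}(k,\nu,\lambda)|\leq\frac{(1-\lambda^2)^{N+1/2}}{2N+1}\left[\max\left(\frac{k^2}{1-k^2},\frac{|\nu|}{\nu+1},1\right)\right]^{N+1/2}f(\lambda,k,\nu), \] and $f(\lambda,k,\nu)$ is given by the following cases. (1) If $\frac{k^2}{1-k^2}>1$ and $\frac{k^2}{1-k^2}>\frac{|\nu|}{\nu+1}$: \[ f=\frac{1}{(1+\nu)k}\left[1-\frac{(1-\lambda^2)k^2}{1-k^2}\right]^{-1}\left[1-\frac{|\nu|(1-k^2)}{(\nu+1)k^2}\right]^{-1}. \] (2) If $\frac{|\nu|}{\nu+1}>\frac{k^2}{1-k^2}>1$: \[ f=\frac{1}{\sqrt{(1-k^2)(1+\nu)|\nu|}}\left[1-\frac{(1-\lambda^2)|\nu|}{1+\nu}\right]^{-1}\left[1-\frac{(\nu+1)k^2}{|\nu|(1-k^2)}\right]^{-1}.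 \] (3) If $\frac{|\nu|}{\nu+1}>1\ge\frac{k^2}{1-k^2}$: \[ f=\frac{1}{\sqrt{(1-k^2)(1+\nu)|\nu|}}\left[1-\frac{(1-\lambda^2)|\nu|}{1+\nu}\right]^{-1}\left(\left[1-\frac{1+\nu}{|\nu|}\right]^{-1}+\frac{1}{\lambda^2}\right). \] (4) If $\frac{k^2}{1-k^2}\le1$ and $\frac{|\nu|}{\nu+1}<1$: \[ f=\frac{1}{(1+\nu)\sqrt{1-k^2}}\left[1-\frac{(1-\lambda^2)|\nu|}{1+\nu}\right]^{-1}\left(\left[1-\frac{|\nu|}{1+\nu}\right]^{-1}+\frac{1}{\lambda^2}\right), \] where $1/\lambda^2$ is read as $+\infty$ (so that the bound is vacuous) if $\lambda=0$. (5) If $\max\left(\frac{k^2}{1-k^2},1\right)=\frac{|\nu|}{\nu+1}$: \[ f=\frac{1}{\sqrt{(1-k^2)(1+\nu)|\nu|}}\left[1-\frac{(1-\lambda^2)|\nu|}{1+\nu}\right]^{-1}\left(\left[1-\frac{(1-\lambda^2)|\nu|}{1+\nu}\right]^{-1}+N\right). \]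
   Context: Legendre's incomplete elliptic integral of the third kind is \[ \Pi(\lambda,\nu,k)=\int_0^\lambda\frac{dt}{(1+\nu t^2)\sqrt{(1-t^2)(1-k^2t^2)}}, \] and $\Pi(\nu,k)=\Pi(1,\nu,k)$ is the complete elliptic integral of the third kind. ${}_2F_1$ is the Gauss hypergeometric function; for a non-negative integer $n$, ${}_2F_1(-n,\tfrac12;1;z)=\sum_{i=0}^{n}\frac{(-n)_i(1/2)_i}{(i!)^2}z^i$ is a polynomial, with $(a)_i=a(a+1)\cdots(a+i-1)$. Convention: $\nu^0=1$ (also for $\nu=0$). *)

(* Defs.v *)
From HB Require Import structures.
From mathcomp Require Import all_boot all_order all_algebra.
From mathcomp Require Import all_classical all_reals all_analysis.

Set Implicit Arguments.
Unset Strict Implicit.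
Unset Printing Implicit Defensive.

Import Order.TTheory GRing.Theory Num.Theory.
Import numFieldNormedType.Exports.

Local Open Scope classical_set_scope.
Local Open Scope ring_scope.

(* Lebesgue integral, so that no separate improper integral is needed when
   lam = 1.  At t = 1 the integrand takes the junk value 0 (as 0^-1 = 0), on a
   null set. *)
Definition ellipticPi (R : realType) (lam nu k : R) : R :=
  \int[lebesgue_measure]_(t in `[0, lam])
    ((1 + nu * t ^+ 2) * Num.sqrt ((1 - t ^+ 2) * (1 - k ^+ 2 * t ^+ 2)))^-1.

Definition completePi (R : realType) (nu k : R) : R := ellipticPi 1 nu k.

Definition pochhammer (R : realType) (a : R) (i : nat) : R :=
  \prod_(j < i) (a + j%:R).

Definition hyp2F1_coef (R : realType) (a b c : R) (i : nat) : R :=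
  pochhammer a i * pochhammer b i / (pochhammer c i * i`!%:R).

(* The sum of the Gauss series; meaningful where the series converges, in
   particular for every z when a = - n%:R (see hyp2F1_terminating). *)
Definition hyp2F1 (R : realType) (a b c z : R) : R :=
  limn (series (fun i => hyp2F1_coef a b c i * z ^+ i)).

Lemma pochhammer1 (R : realType) (i : nat) : pochhammer (1 : R) i = i`!%:R.
Proof.
elim: i => [|i IH]; first by rewrite /pochhammer big_ord0.
by rewrite /pochhammer big_ord_recr /= -/(pochhammer 1 i) IH factS natrM mulrC
  nat1r.
Qed.

Lemma pochhammer_eq0 (R : realType) (n i : nat) :
  (n < i)%N -> pochhammer (- n%:R : R) i = 0.
Proof.
by move=> ni; rewrite /pochhammer (bigD1 (Ordinal ni)) //= addNr mul0r.
Qed.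

Lemma hyp2F1_terminating (R : realType) (n : nat) (z : R) :
  hyp2F1 (- n%:R) (2^-1) 1 z =
  \sum_(i < n.+1)
    pochhammer (- n%:R) i * pochhammer (2^-1) i / (i`!%:R ^+ 2) * z ^+ i.
Proof.
apply: cvg_lim => //; apply: cvg_near_cst; exists n.+1 => // m /= nm.
rewrite /series /= (big_cat_nat (leq0n n.+1) nm) //= [X in _ + X]big1_seq ?addr0.
  rewrite big_mkord; apply: eq_bigr => i _.
  by rewrite /hyp2F1_coef pochhammer1 expr2.
move=> i /andP[_]; rewrite mem_index_iota => /andP[ni _].
by rewrite /hyp2F1_coef pochhammer_eq0 // !mul0r.
Qed.

(* Main.v *)
(* Substituting x = 1 - t^2, the part of the complete integral over [lam, 1] has
   integrand K (t / sqrt x) H(x), where K = 1 / ((1 + nu) sqrt (1 - k^2)) and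
   H(x) = 1 / ((1 - a x) sqrt (1 - x) sqrt (1 + b x)) with a = nu / (1 + nu) and
   b = k^2 / (1 - k^2).  The coefficients of 1 / sqrt ((1 - x) (1 + b x)) are the
   numbers 2F1(-n, 1/2; 1; 1 + b), so those of H are the inner sums of the
   expansion.  They are convolutions of the nonnegative coefficients c_j of
   1 / sqrt (1 - x), and sum_j c_j c_(n-j) = 1; hence the coefficient of x^m is at
   most sum_n max(1, b)^n |a|^(m-n) in absolute value.  The tail of the series from
   m = N on is therefore at most c x^N with an explicit constant c, and integrating
   this against t / sqrt x over [lam, 1] produces the error bound. *)

Require Import Defs.
From HB Require Import structures.
From mathcomp Require Import all_boot all_order all_algebra.
From mathcomp Require Import all_classical all_reals all_analysis.
From mathcomp Require Import measurable_realfun ring lra.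

Set Implicit Arguments.
Unset Strict Implicit.
Unset Printing Implicit Defensive.

Import Order.TTheory GRing.Theory Num.Theory.
Import numFieldNormedType.Exports.

Local Open Scope classical_set_scope.
Local Open Scope ring_scope.

(** * The coefficients as values of 2F1 *)

Section Moments.
Variable R : realType.
Implicit Types (b z : R) (i j n p : nat).

(** The Taylor coefficients of [1 / sqrt (1 - x)], equal to ['C(2 i, i) / 4 ^ i]; they are also the
    moments of the arcsine law on [[0, 1]]. *)
Definition isqrt_coef i : R := pochhammer 2^-1 i / i`!%:R.

Lemma pochhammerS (a : R) i : pochhammer a i.+1 = pochhammer a i * (a + i%:R).
Proof. by rewrite /pochhammer big_ord_recr. Qed.

Lemma pochhammer_opp n i :
  (i <= n)%N -> pochhammer (- n%:R : R) i = (-1) ^+ i * (n ^_ i)%:R.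
Proof.
elim: i => [|i IH] lin; first by rewrite /pochhammer big_ord0 mulr1.
rewrite pochhammerS IH ?(ltnW lin)// ffactnSr natrM natrB ?(ltnW lin)// exprSr.
ring.
Qed.

Lemma factr_neq0 n : n`!%:R != 0 :> R.
Proof. by rewrite pnatr_eq0 -lt0n fact_gt0. Qed.

(** Truncation at degree [n] keeps the sum finite; it captures all of [q] once [q] has degree at
    most [n], hence the condition [j + p <= n] below. *)
Let L n (q : {poly R}) : R := \sum_(i < n.+1) q`_i * isqrt_coef i.

Let LB n q r : L n (q - r) = L n q - L n r.
Proof.
by rewrite /L -sumrB; apply: eq_bigr => i _; rewrite coefB mulrBl.
Qed.

(* Applied to 'X^j * (1 - 'X)^p, the functional 'X^i |-> isqrt_coef i yields the
   corresponding moment of the arcsine law, a value of the Beta function. *)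
Lemma isqrt_moment n j p : (j + p <= n)%N ->
  \sum_(i < n.+1) ('X^j * (1 - 'X) ^+ p : {poly R})`_i * isqrt_coef i =
  pochhammer 2^-1 j * pochhammer 2^-1 p / (j + p)`!%:R.
Proof.
rewrite -/(L _ _); elim: p j => [|p IH] j.
  rewrite addn0 expr0 mulr1 /L => jn.
  rewrite (bigD1 (Ordinal (jn : (j < n.+1)%N)))//= coefXn eqxx mul1r.
  rewrite big1 ?addr0 => [|i /eqP/val_eqP/= /negbTE ij]; last first.
    by rewrite coefXn ij mul0r.
  by rewrite /isqrt_coef [in RHS]/pochhammer [X in _ * X / _]big_ord0 mulr1.
rewrite addnS => jpn.
(* The Beta recursion B(j, p + 1) = B(j, p) - B(j + 1, p) drives the induction, so [j] is kept
   general. *)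
have -> : 'X^j * (1 - 'X) ^+ p.+1 =
    'X^j * (1 - 'X) ^+ p - 'X^(j.+1) * (1 - 'X) ^+ p :> {poly R}.
  by rewrite !exprS; ring.
rewrite LB !IH ?(ltnW jpn)// addSn !pochhammerS factS natrM.
rewrite -[X in X * _`!%:R]natr1 natrD.
have jp1 : j%:R + p%:R + 1 != 0 :> R by rewrite gt_eqF// -natrD natr1 ltr0n.
by have := factr_neq0 (j + p) => f0; field; apply/andP.
Qed.

(** Both sides are [L n] of [(1 - z X)^n]. Expanding in powers of [X] gives the Gauss sum; expanding
    [((1 - X) + (1 - z) X)^n] gives the convolution, by [isqrt_moment]. *)
Lemma hyp2F1_half n z : hyp2F1 (- n%:R) 2^-1 1 z =
  \sum_(j < n.+1) isqrt_coef j * isqrt_coef (n - j) * (1 - z) ^+ j.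
Proof.
rewrite hyp2F1_terminating.
transitivity (L n ((1 - z *: 'X) ^+ n)).
  have -> : (1 - z *: 'X) ^+ n =
      \poly_(i < n.+1) ((- z) ^+ i * 'C(n, i)%:R) :> {poly R}.
    rewrite -scaleNr exprDn poly_def; apply: eq_bigr => i _.
    by rewrite expr1n mul1r exprZn scalerMnl mulr_natr.
  apply: eq_bigr => i _; have lin : (i <= n)%N by rewrite -ltnS.
  rewrite coef_poly ltn_ord pochhammer_opp// -bin_ffact natrM /isqrt_coef.
  rewrite -[in RHS]mulN1r exprMn.
  by have := factr_neq0 i => f0; field.
have -> : 1 - z *: 'X = (1 - 'X) + (1 - z) *: 'X :> {poly R}.
  by rewrite scalerBl scale1r; ring.
rewrite exprDn {1}/L.
under eq_bigr do rewrite coef_sum mulr_suml.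
rewrite exchange_big; apply: eq_bigr => j _.
have ljn : (j <= n)%N by rewrite -ltnS.
under eq_bigr do
  rewrite exprZn -(scalerAr _ ((1 - 'X) ^+ (n - j))) coefMn coefZ
    -mulrnAl -mulrA.
rewrite -mulr_sumr.
under eq_bigr do rewrite [_ ^+ (n - j) * _]mulrC.
rewrite isqrt_moment subnKC// /isqrt_coef.
rewrite -(bin_fact ljn) !natrM.
have := factr_neq0 j; have := factr_neq0 (n - j) => f0 f1.
have b0 : 'C(n, j)%:R != 0 :> R by rewrite pnatr_eq0 -lt0n bin_gt0.
rewrite -mulr_natr; field.
by rewrite f0 f1 b0.
Qed.

End Moments.

(** * Power series *)

Section Geometric.
Variable R : realType.
Implicit Types (u v : nat -> R) (r : R) (n M : nat).

Lemma eq_cvgn u v (l : R) : u @ \oo --> l -> u =1 v -> v @ \oo --> l.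
Proof. by move=> ul /funext <-. Qed.

Lemma geometric_sum_le r m n : 0 <= r -> r < 1 ->
  \sum_(m <= i < n) r ^+ i <= r ^+ m / (1 - r).
Proof.
move=> r0 r1; have r1' : 0 < 1 - r by rewrite subr_gt0.
rewrite ler_pdivlMr//; have [nm|mn] := leqP n m.
  by rewrite big_geq// mul0r exprn_ge0.
have -> : (\sum_(m <= i < n) r ^+ i) * (1 - r) = r ^+ m - r ^+ n.
  rewrite mulr_suml -[RHS]opprB -telescope_sumr ?(ltnW mn)// -sumrN.
  by apply: eq_bigr => i _; rewrite exprS; ring.
by rewrite gerBl exprn_ge0.
Qed.

(** With [s = sqrt r], each [s ^+ i] for [i < n] is at least [s ^+ n], so [n s^n <= 1 / (1 - s)] and
    hence [n r^n <= s^n / (1 - s)]. *)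
Lemma cvg_mulrn_expr r : 0 <= r -> r < 1 ->
  (fun n => n%:R * r ^+ n) @ \oo --> (0 : R).
Proof.
move=> r0 r1; set s := Num.sqrt r.
have s0 : 0 <= s by exact: sqrtr_ge0.
have s1 : s < 1 by rewrite -[1]sqrtr1 ltr_sqrt.
apply: (@squeeze_cvgr _ _ _ _ (cst 0) (fun n => (1 - s)^-1 * s ^+ n)).
- near=> n; rewrite mulr_ge0 ?exprn_ge0//=.
  rewrite -(sqr_sqrtr r0) -/s -exprM mulnC exprM expr2 mulrA.
  rewrite ler_wpM2r ?exprn_ge0//.
  apply: le_trans (_ : \sum_(0 <= i < n) s ^+ i <= _).
    rewrite big_mkord mulr_natl -[X in _ *+ X](card_ord n) -sumr_const.
    apply: ler_sum => i _.
    by apply: ler_wiXn2l; rewrite // ?(ltW s1)// ltnW.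
  by rewrite (le_trans (geometric_sum_le _ _ _ _))// expr0 mul1r.
- exact: cvg_cst.
- rewrite -[0](mulr0 (1 - s)^-1); apply: cvgMr.
  by apply: cvg_expr; rewrite ger0_norm.
Unshelve. all: end_near. Qed.

Lemma sum_conv u v M :
  \sum_(n < M) \sum_(j < n.+1) u j * v (n - j)%N =
  \sum_(j < M) u j * \sum_(i < (M - j)%N) v i.
Proof.
elim: M => [|M IH]; first by rewrite !big_ord0.
rewrite big_ord_recr/= IH [RHS]big_ord_recr/= [in LHS]big_ord_recr/=.
rewrite subnn subSnn big_ord1 addrA -big_split/=; congr (_ + _).
apply: eq_bigr => j _; rewrite subSn ?(ltnW (ltn_ord j))// big_ord_recr/=.
by rewrite mulrDr.
Qed.

(** The difference is the sum over [j < M] of [u j] times the block of [v i] with [M - j <= i < M].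
    Each summand is at most [r^j r^(M - j) / (1 - r)], so the total is at most [M r^M / (1 - r)]. *)
Lemma cvg_conv u v r : 0 <= r -> r < 1 ->
  (forall n, `|u n| <= r ^+ n) -> (forall n, `|v n| <= r ^+ n) ->
  (fun M => (\sum_(n < M) u n) * (\sum_(n < M) v n) -
     \sum_(n < M) \sum_(j < n.+1) u j * v (n - j)%N) @ \oo --> (0 : R).
Proof.
move=> r0 r1 ur vr; apply/norm_cvg0P.
apply: (@squeeze_cvgr _ _ _ _ (cst 0) (fun M => (1 - r)^-1 * (M%:R * r ^+ M))).
- near=> M; rewrite normr_ge0/= sum_conv mulr_suml -sumrB.
  apply: le_trans (ler_norm_sum _ _ _) _.
  apply: (@le_trans _ _ (\sum_(j < M) (1 - r)^-1 * r ^+ M)); last first.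
    by rewrite sumr_const card_ord -[leLHS]mulr_natl mulrCA.
  apply: ler_sum => j _; have jM := ltnW (ltn_ord j).
  rewrite -mulrBr normrM -(big_mkord xpredT v) -(big_mkord xpredT v).
  rewrite (big_cat_nat (leq0n (M - j)) (leq_subr _ _))/= addrAC subrr add0r.
  rewrite -[X in _ ^+ X](subnKC jM) exprD mulrCA ler_pM//.
  rewrite mulrC; apply: le_trans (geometric_sum_le _ M r0 r1).
  by apply: le_trans (ler_norm_sum _ _ _) _; exact: ler_sum.
- exact: cvg_cst.
- rewrite -[0](mulr0 (1 - r)^-1); apply: cvgMr; exact: cvg_mulrn_expr.
Unshelve. all: end_near. Qed.

Lemma cvg_conv_mul u v r (l l' : R) : 0 <= r -> r < 1 ->
  (forall n, `|u n| <= r ^+ n) -> (forall n, `|v n| <= r ^+ n) ->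
  (fun M => \sum_(n < M) u n) @ \oo --> l ->
  (fun M => \sum_(n < M) v n) @ \oo --> l' ->
  (fun M => \sum_(n < M) \sum_(j < n.+1) u j * v (n - j)%N) @ \oo --> l * l'.
Proof.
move=> r0 r1 ur vr ul vl'.
rewrite -[l * l']subr0.
apply: eq_cvgn (cvgB (cvgM ul vl') (cvg_conv r0 r1 ur vr)) _ => M.
by rewrite !fctE opprB addrC subrK.
Qed.

End Geometric.

(** * Inverse square roots and the integrand as Cauchy products *)

Section InverseSquareRootSeries.
Variable R : realType.
Implicit Types (a b u x : R) (i j n m M : nat).
Local Notation c := (@isqrt_coef R).

Lemma isqrt_coefS i : c i.+1 = c i * ((2^-1 + i%:R) / i.+1%:R).
Proof.
rewrite /isqrt_coef pochhammerS factS natrM.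
by rewrite mulrACA invfM [X in _ * X = _]mulrC.
Qed.

Lemma isqrt_coef_ge0 i : 0 <= c i.
Proof.
rewrite /isqrt_coef divr_ge0//; apply: prodr_ge0 => j _.
by rewrite addr_ge0// invr_ge0.
Qed.

Lemma isqrt_coef_dec i : c i.+1 <= c i.
Proof.
rewrite isqrt_coefS ler_piMr ?isqrt_coef_ge0//.
rewrite ler_pdivrMr ?ltr0n// mul1r -[in leRHS]natr1; lra.
Qed.

(** This is [hyp2F1_half] at [z = 0], where only the constant term of the Gauss sum survives. *)
Lemma isqrt_coef_conv n : \sum_(j < n.+1) c j * c (n - j) = 1.
Proof.
have := hyp2F1_half n (0 : R); rewrite hyp2F1_terminating subr0.
under [RHS]eq_bigr do rewrite expr1n mulr1.
move=> <-; rewrite big_ord_recl/= big1 ?addr0; last first.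
  by move=> i _; rewrite expr0n/= mulr0.
by rewrite /pochhammer !big_ord0 expr0 fact0 expr1n !mulr1 divr1.
Qed.

Lemma isqrt_coef_le1 i : c i <= 1.
Proof.
elim: i => [|i]; last exact/le_trans/isqrt_coef_dec.
by rewrite /isqrt_coef /pochhammer big_ord0 fact0 divr1.
Qed.

Lemma isqrt_term_le u i : `|c i * u ^+ i| <= `|u| ^+ i.
Proof.
rewrite normrM normrX ger0_norm ?isqrt_coef_ge0//.
by rewrite ler_piMl ?isqrt_coef_le1// exprn_ge0.
Qed.

Lemma expr_split u n (j : 'I_n.+1) : u ^+ n = u ^+ j * u ^+ (n - j).
Proof. by rewrite -exprD subnKC// -ltnS. Qed.

(** For negative [u], terms are paired as [u^(2m) (c_(2m) + c_(2m+1) u)], nonnegative because [c]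
    decreases and [u >= -1]. This fixes the sign when a square root is taken in [cvg_isqrt]. *)
Lemma isqrt_sum_ge0 u M : -1 <= u -> 0 <= \sum_(i < M) c i * u ^+ i.
Proof.
move=> u1; have [u0|u0] := leP 0 u.
  by apply: sumr_ge0 => i _; rewrite mulr_ge0 ?isqrt_coef_ge0 ?exprn_ge0.
have even_ge0 k : 0 <= u ^+ k.*2 by rewrite -mul2n exprM exprn_ge0 ?sqr_ge0.
have sum_even m : 0 <= \sum_(i < m.*2) c i * u ^+ i.
  elim: m => [|m IH]; first by rewrite big_ord0.
  rewrite doubleS !big_ord_recr/= -addrA addr_ge0// exprS mulrA -mulrDl.
  rewrite mulr_ge0//.
  have := isqrt_coef_dec m.*2; have := isqrt_coef_ge0 m.*2.+1; nra.
rewrite -(odd_double_half M); case: (odd M); last by rewrite add0n.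
rewrite add1n big_ord_recr/=; apply: addr_ge0; first exact: sum_even.
by rewrite mulr_ge0 ?isqrt_coef_ge0.
Qed.

(** The self-convolution of [c i * u ^+ i] is the geometric sequence, so the squared partial sums
    tend to [1 / (1 - u)]; as the partial sums are nonnegative, continuity of the square root gives
    their limit. *)
Lemma cvg_isqrt u : `|u| < 1 ->
  (fun M => \sum_(i < M) c i * u ^+ i) @ \oo --> (Num.sqrt (1 - u))^-1.
Proof.
move=> u1; set S := fun M => _.
have [uN1 u1'] : -1 < u /\ u < 1 by apply/andP; rewrite -ltr_norml.
have conv1 n : \sum_(j < n.+1) c j * u ^+ j * (c (n - j)%N * u ^+ (n - j)) =
    u ^+ n.
  rewrite -[RHS]mul1r -(isqrt_coef_conv n) mulr_suml; apply: eq_bigr => j _.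
  by rewrite (expr_split u j); ring.
have SS : (fun M => S M * S M) @ \oo --> (1 - u)^-1.
  have := cvg_conv (normr_ge0 u) u1 (isqrt_term_le u) (isqrt_term_le u).
  have := @cvg_geometric_series R 1 _ u1; rewrite mul1r => g h.
  rewrite -[_^-1]addr0; apply: eq_cvgn (cvgD g h) _ => M.
  rewrite !fctE /series/= big_mkord.
  under [X in _ + (_ - X)]eq_bigr do rewrite conv1.
  under [X in X + _]eq_bigr do rewrite mul1r.
  by rewrite addrC subrK.
rewrite -sqrtrV; last by rewrite subr_ge0 ltW.
apply: eq_cvgn (continuous_cvg _ (@sqrt_continuous R _) SS) _ => M.
rewrite -[LHS]/(Num.sqrt (S M * S M)) -expr2 sqrtr_sqr.
by rewrite ger0_norm// isqrt_sum_ge0// ltW.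
Qed.

Definition isqrt2_coef b n := \sum_(j < n.+1) c j * c (n - j) * (- b) ^+ j.

(** The weights [c j * c (n - j)] are nonnegative and sum to 1, so the coefficient is an average of
    the numbers [(- b) ^+ j], each at most [max 1 b ^+ n] in absolute value. *)
Lemma isqrt2_coef_le b n : 0 <= b -> `|isqrt2_coef b n| <= Num.max 1 b ^+ n.
Proof.
move=> b0; set C := Num.max 1 b.
have C1 : 1 <= C by rewrite le_max lexx.
have Cb : b <= C by rewrite le_max lexx orbT.
rewrite -[leRHS]mul1r -(isqrt_coef_conv n) mulr_suml.
apply: le_trans (ler_norm_sum _ _ _) _; apply: ler_sum => j _.
have cc : 0 <= c j * c (n - j).
  by apply: mulr_ge0; exact: isqrt_coef_ge0.
rewrite normrM (ger0_norm cc); apply: ler_wpM2l => //.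
rewrite normrX normrN ger0_norm// (expr_split C j) -[leLHS]mulr1.
by rewrite ler_pM ?exprn_ge0 ?exprn_ege1// lerXn2r// nnegrE (le_trans b0).
Qed.

Lemma cvg_isqrt2 b x : 0 <= b -> 0 <= x -> Num.max 1 b * x < 1 ->
  (fun M => \sum_(n < M) isqrt2_coef b n * x ^+ n) @ \oo -->
  (Num.sqrt (1 - x) * Num.sqrt (1 + b * x))^-1.
Proof.
move=> b0 x0 Cx; set C := Num.max 1 b in Cx.
have C1 : 1 <= C by rewrite le_max lexx.
have Cb : b <= C by rewrite le_max lexx orbT.
have Cx0 : 0 <= C * x by rewrite mulr_ge0// (le_trans ler01).
have xC : x <= C * x by rewrite ler_peMl.
have bxC : b * x <= C * x by rewrite ler_wpM2r.
have bx0 : 0 <= b * x by rewrite mulr_ge0.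
have Nx : `|x| = x by rewrite ger0_norm.
have Nbx : `|- (b * x)| = b * x by rewrite normrN ger0_norm.
rewrite invfM mulrC.
have bx_cvg := @cvg_isqrt (- (b * x)); rewrite opprK Nbx in bx_cvg.
have x_cvg := @cvg_isqrt x; rewrite Nx in x_cvg.
apply: eq_cvgn (@cvg_conv_mul R (fun i => c i * (- (b * x)) ^+ i)
  (fun i => c i * x ^+ i) _ _ _ Cx0 Cx _ _ (bx_cvg _) (x_cvg _)) _; last first.
- move=> M; apply: eq_bigr => n _; rewrite /isqrt2_coef mulr_suml.
  by apply: eq_bigr => j _; rewrite (expr_split x j) -mulNr exprMn; ring.
- exact: le_lt_trans Cx.
- exact: le_lt_trans Cx.
- move=> n; apply: le_trans (isqrt_term_le _ _) _.
  by rewrite Nx lerXn2r.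
- move=> n; apply: le_trans (isqrt_term_le _ _) _.
  by rewrite Nbx lerXn2r.
Qed.

Definition integrand_coef a b m :=
  \sum_(n < m.+1) isqrt2_coef b n * a ^+ (m - n).

Lemma cvg_integrand a b x : 0 <= b -> 0 <= x -> Num.max 1 b * x < 1 ->
  `|a| * x < 1 ->
  (fun M => \sum_(m < M) integrand_coef a b m * x ^+ m) @ \oo -->
  ((1 - a * x) * (Num.sqrt (1 - x) * Num.sqrt (1 + b * x)))^-1.
Proof.
move=> b0 x0 Cx ax; rewrite invfM mulrC.
have C0 : 0 <= Num.max 1 b by rewrite le_max ler01.
(* A single ratio below 1 dominating both factors, as [cvg_conv_mul] requires. *)
pose r := Num.max (Num.max 1 b * x) (`|a| * x).
have r0 : 0 <= r by rewrite le_max !mulr_ge0.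
have r1 : r < 1 by rewrite gt_max Cx.
have ax' : `|a * x| < 1 by rewrite normrM (ger0_norm x0).
have gax : (fun M => \sum_(n < M) (a * x) ^+ n) @ \oo --> (1 - a * x)^-1.
  rewrite -[_^-1]mul1r; apply: eq_cvgn (cvg_geometric_series ax') _ => M.
  rewrite /series/= big_mkord.
  by apply: eq_bigr => i _; rewrite mul1r.
apply: eq_cvgn (@cvg_conv_mul R (fun n => isqrt2_coef b n * x ^+ n)
  (fun n => (a * x) ^+ n) _ _ _ r0 r1 _ _ (cvg_isqrt2 b0 x0 Cx) gax) _ => n.
- rewrite normrM normrX (ger0_norm x0).
  apply: le_trans (ler_wpM2r _ (isqrt2_coef_le _ b0)) _; first exact: exprn_ge0.
  by rewrite -exprMn lerXn2r ?nnegrE ?mulr_ge0// le_max lexx.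
- rewrite normrX normrM (ger0_norm x0).
  by rewrite lerXn2r ?nnegrE ?mulr_ge0// le_max lexx orbT.
- apply: eq_bigr => m _; rewrite /integrand_coef mulr_suml.
  by apply: eq_bigr => j _; rewrite (expr_split x j) exprMn; ring.
Qed.

End InverseSquareRootSeries.

(** * Tail estimates for the expansion of the integrand *)

Section Tail.
Variable R : realType.
Implicit Types (a b x y : R) (n m M N : nat) (f g : nat -> R).

(** The block from [N] to [M] telescopes to at most [g N - g M <= g N], and the bound passes to the
    limit in [M]. *)
Lemma series_tail_le f g (l : R) N :
  (fun M => \sum_(m < M) f m) @ \oo --> l ->
  (forall m, 0 <= g m) -> (forall m, `|f m| <= g m - g m.+1) ->
  `|l - \sum_(m < N) f m| <= g N.
Proof.
move=> fl g0 fg.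
have fNl : (fun M => `|(\sum_(m < M) f m) - \sum_(m < N) f m|) @ \oo -->
    `|l - \sum_(m < N) f m|.
  by apply: cvg_norm; apply: cvgB fl _; exact: cvg_cst.
apply: cvgr_to_le fNl _; exists N => // M /= NM.
rewrite -!(big_mkord xpredT f) (big_cat_nat (leq0n N) NM)/= addrAC subrr add0r.
apply: le_trans (ler_norm_sum _ _ _) _.
apply: (@le_trans _ _ (\sum_(N <= m < M) (g m - g m.+1))); first exact: ler_sum.
rewrite -[leLHS]opprK -sumrN; under eq_bigr do rewrite opprB.
by rewrite telescope_sumr// opprB gerBl.
Qed.

Lemma geometric_tail y m : y != 1 ->
  y ^+ m = y ^+ m / (1 - y) - y ^+ m.+1 / (1 - y).
Proof. by move=> y1; rewrite exprS; field; rewrite subr_eq0 eq_sym. Qed.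

(** The subtracted expressions are the exact tails of the series of [(i + 1) y^i] from [m] and from
    [m + 1]; this is the telescoping form that [series_tail_le] consumes. *)
Lemma arith_geometric_tail y m : y != 1 ->
  m.+1%:R * y ^+ m = y ^+ m / (1 - y) * (m%:R + (1 - y)^-1) -
    y ^+ m.+1 / (1 - y) * (m.+1%:R + (1 - y)^-1).
Proof.
move=> y1; rewrite exprS -natr1; field; by rewrite subr_eq0 eq_sym.
Qed.

(** Reversing the sum exchanges [x] and [y]. For [y < x] the sum is [(x^(m+1) - y^(m+1)) / (x - y)];
    dropping [y^(m+1)] gives the bound. *)
Lemma mixed_geometric_le x y m : 0 <= x -> 0 <= y -> x != y ->
  \sum_(n < m.+1) y ^+ n * x ^+ (m - n) <=
  Num.max x y ^+ m / (1 - Num.min x y / Num.max x y).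
Proof.
wlog xy : x y / y < x => [H x0 y0 xy|x0 y0 _].
  have [yx|] := boolP (y < x); first exact: H.
  rewrite -leNgt => yx; have {}yx : x < y by rewrite lt_neqAle xy.
  have -> : \sum_(n < m.+1) y ^+ n * x ^+ (m - n) =
      \sum_(n < m.+1) x ^+ n * y ^+ (m - n).
    rewrite (reindex_inj rev_ord_inj); apply: eq_bigr => n _ /=.
    by rewrite subSS subKn 1?mulrC// -ltnS.
  by rewrite maxC minC; apply: H; rewrite // eq_sym.
rewrite max_l ?min_r ?(ltW xy)//.
have x_gt0 : 0 < x by rewrite (le_lt_trans y0).
have xyD : 0 < x - y by rewrite subr_gt0.
have -> : x ^+ m / (1 - y / x) = x ^+ m.+1 / (x - y).
  by rewrite exprS; field; rewrite !gt_eqF.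
rewrite ler_pdivlMr//.
have -> : (\sum_(n < m.+1) y ^+ n * x ^+ (m - n)) * (x - y) =
    x ^+ m.+1 - y ^+ m.+1.
  rewrite subrXX mulrC; congr (_ * _); apply: eq_bigr => n _.
  by rewrite mulrC.
by rewrite gerBl exprn_ge0.
Qed.

Lemma integrand_coef_le a b m : 0 <= b ->
  `|integrand_coef a b m| <= \sum_(n < m.+1) Num.max 1 b ^+ n * `|a| ^+ (m - n).
Proof.
move=> b0; apply: le_trans (ler_norm_sum _ _ _) _; apply: ler_sum => n _.
by rewrite normrM normrX ler_wpM2r ?exprn_ge0// isqrt2_coef_le.
Qed.

Definition integrand a b x :=
  ((1 - a * x) * (Num.sqrt (1 - x) * Num.sqrt (1 + b * x)))^-1.

Let lt1_mul z x x0 : 0 <= x -> x <= x0 -> z * x0 < 1 -> z * x < 1.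
Proof.
move=> x_ge0 xx0; have [z0 zx0|/ltW z0 _] := leP 0 z.
  by apply: le_lt_trans zx0; rewrite ler_wpM2l.
by rewrite (le_lt_trans _ ltr01)// mulr_le0_ge0.
Qed.

Section GeometricBound.
Variables (a b x0 x : R).
Hypotheses (b0 : 0 <= b) (Cx0 : Num.max 1 b * x0 < 1) (ax0 : `|a| * x0 < 1).
Hypotheses (x_ge0 : 0 <= x) (xx0 : x <= x0).

Let cvg_x : (fun M => \sum_(m < M) integrand_coef a b m * x ^+ m) @ \oo -->
  integrand a b x.
Proof. by apply: cvg_integrand; rewrite // (lt1_mul _ xx0). Qed.

(** Replacing [1 / (1 - D x)] by its larger value at [x0] makes the constant uniform on [[0, x0]],
    while the factor [x ^+ N] is kept for the integration. *)
Lemma integrand_geometric_tail B D N : 0 <= B -> 0 <= D -> D * x0 < 1 ->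
  (forall m, `|integrand_coef a b m| <= B * D ^+ m) ->
  `|integrand a b x - \sum_(m < N) integrand_coef a b m * x ^+ m| <=
  B * D ^+ N / (1 - D * x0) * x ^+ N.
Proof.
move=> B0 D0 Dx0 coefB; have Dx := lt1_mul x_ge0 xx0 Dx0.
have Dx_ge0 : 0 <= D * x by rewrite mulr_ge0.
pose g m := B * ((D * x) ^+ m / (1 - D * x)).
have g0 m : 0 <= g m by rewrite !mulr_ge0 ?exprn_ge0// invr_ge0 subr_ge0 ltW.
apply: le_trans (series_tail_le (f := fun m => integrand_coef a b m * x ^+ m)
    N cvg_x g0 _) _ => [m|].
  rewrite -mulrBr -geometric_tail ?lt_eqF// normrM normrX (ger0_norm x_ge0).
  by rewrite exprMn mulrA ler_wpM2r ?exprn_ge0.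
rewrite /g exprMn -!mulrA; do 2!rewrite ler_wpM2l ?exprn_ge0//.
rewrite mulrC ler_wpM2r ?exprn_ge0// lef_pV2 ?posrE ?subr_gt0//.
by rewrite lerD2l lerN2 ler_wpM2l.
Qed.

(** The variant for two equal ratios, where the coefficient bound acquires the factor [m + 1]. *)
Lemma integrand_arith_geometric_tail D N : 0 <= D -> D * x0 < 1 ->
  (forall m, `|integrand_coef a b m| <= m.+1%:R * D ^+ m) ->
  `|integrand a b x - \sum_(m < N) integrand_coef a b m * x ^+ m| <=
  D ^+ N / (1 - D * x0) * ((1 - D * x0)^-1 + N%:R) * x ^+ N.
Proof.
move=> D0 Dx0 coefB; have Dx := lt1_mul x_ge0 xx0 Dx0.
have Dx_ge0 : 0 <= D * x by rewrite mulr_ge0.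
pose g m := (D * x) ^+ m / (1 - D * x) * (m%:R + (1 - D * x)^-1).
have V0 : 0 <= (1 - D * x)^-1 by rewrite invr_ge0 subr_ge0 ltW.
have g0 m : 0 <= g m by rewrite !mulr_ge0 ?addr_ge0 ?exprn_ge0.
apply: le_trans (series_tail_le (f := fun m => integrand_coef a b m * x ^+ m)
    N cvg_x g0 _) _ => [m|].
  rewrite -arith_geometric_tail ?lt_eqF// normrM normrX (ger0_norm x_ge0).
  by rewrite exprMn mulrA ler_wpM2r ?exprn_ge0.
have Vle : (1 - D * x)^-1 <= (1 - D * x0)^-1.
  by rewrite lef_pV2 ?posrE ?subr_gt0// lerD2l lerN2 ler_wpM2l.
rewrite /g exprMn -!mulrA ler_wpM2l ?exprn_ge0// [leLHS]mulrC.
rewrite [leRHS]mulrA ler_wpM2r ?exprn_ge0// ler_pM ?addr_ge0//.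
by rewrite addrC lerD2r.
Qed.

End GeometricBound.

End Tail.

(** * Integrals with a singular endpoint *)

Section ImproperFTC.
Variable R : realType.
Notation mu := (@lebesgue_measure R).
Implicit Types (f F : R -> R) (a b : R).

Lemma measurable_fun_continuous_co f a b :
  {in `[a, b[, forall x, {for x, continuous f}} ->
  measurable_fun (`[a, b] : set R) f.
Proof.
move=> cf; apply/measurable_fun_itv_bndo_bndcP.
apply: subspace_continuous_measurable_fun; first exact: measurable_itv.
by apply: continuous_in_subspaceT => x; rewrite inE/=; exact: cf.
Qed.

(** The ordinary theorem applies on each [[a, c n]] with [c n] increasing to [b]; monotone
    convergence handles the left side and continuity of [F] at [b] the right side. The singular
    value [f b] sits on a null set. *)
Lemma ge0_FTC2_improper f F a b : a < b ->
  {in `[a, b[, forall x, 0 <= f x} ->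
  {in `[a, b[, forall x, {for x, continuous f}} ->
  {in `[a, b[, forall x, is_derive x (1 : R) F (f x)} ->
  {for b, continuous F} ->
  (\int[mu]_(x in `[a, b]) (f x)%:E = (F b - F a)%:E)%E.
Proof.
move=> ab f0 cf dF cF.
have mf := measurable_fun_continuous_co cf.
rewrite -integral_itv_bndo_bndc; last first.
  by apply/measurable_EFinP/measurable_fun_itv_bndo_bndcP.
(* The shift by 2 makes [a < c n] strict already at [n = 0]. *)
pose c n : R := b - (b - a) * n.+2%:R^-1.
have ba : 0 < b - a by rewrite subr_gt0.
have cb n : c n < b by rewrite ltrBlDr ltrDl mulr_gt0.
have ac n : a < c n.
  by rewrite ltrBrDr -ltrBrDl gtr_pMr// invf_lt1// ltr1n.
have cc m n : (m <= n)%N -> c m <= c n.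
  move=> mn; rewrite lerD2l lerN2 ler_wpM2l ?(ltW ba)//.
  by rewrite lef_pV2 ?posrE// ler_nat.
have c_cvg : c @ \oo --> b.
  rewrite -[X in _ --> X]subr0 -(mulr0 (b - a)).
  apply: cvgB; first exact: cvg_cst.
  apply: cvgMr; have := @cvg_harmonic R.
  move/(cvg_comp _ _ (@cvg_addnr 1)).
  by under eq_fun do rewrite /harmonic/= addn1.
have -> : `[a, b[%classic = \bigcup_n `[a, c n]%classic.
  apply/seteqP; split=> [x/=|x [n _]/=]; rewrite !in_itv/=; last first.
    by move=> /andP[-> /le_lt_trans->].
  move=> /andP[ax xb]; have /(cvgr_gt _ c_cvg)[n _ /(_ n)/= xc] := xb.
  by exists n => //=; rewrite in_itv/= ax ltW ?xc.
have intc n : (\int[mu]_(x in `[a, c n]) (f x)%:E = (F (c n) - F a)%:E)%E.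
  have sub x : x \in `[a, c n] -> x \in `[a, b[.
    by rewrite !in_itv/= => /andP[-> /le_lt_trans->].
  have wF : {within `[a, c n], continuous F}.
    apply: derivable_within_continuous => x /sub xab.
    by have := dF _ xab => ?; exact: ex_derive.
  rewrite (@continuous_FTC2 _ f F)//.
  - by apply: continuous_in_subspaceT => x; rewrite inE/= => /sub; exact: cf.
  - move/(continuous_within_itvP _ (ac n)) : wF => [_ ? ?]; split => // x xac.
    have /sub xab : x \in `[a, c n] by exact: subset_itv_oo_cc xac.
    by have := dF _ xab => ?; exact: ex_derive.
  - move=> x xac.
    have /sub xab : x \in `[a, c n] by exact: subset_itv_oo_cc xac.
    by have := dF _ xab => ?; rewrite derive1E derive_val.
have F_cvg : (fun n => (F (c n) - F a)%:E) @ \oo --> (F b - F a)%:E.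
  apply: cvg_EFin; first exact: nearW.
  apply: cvgB; last exact: cvg_cst.
  exact: continuous_cvg cF c_cvg.
apply: cvg_unique F_cvg => //=; rewrite -(eq_cvg _ _ intc).
apply: ge0_nondecreasing_set_cvg_integral.
- move=> m n mn; rewrite subsetEset; apply: subset_itvl.
  by rewrite bnd_simp cc.
- by move=> n; exact: measurable_itv.
- move=> n; apply/measurable_EFinP; apply: measurable_funS mf => //.
  by apply: subset_itvl; rewrite bnd_simp ltW.
- move=> n x /=; rewrite in_itv/= => /andP[ax xc].
  by rewrite lee_fin f0// in_itv/= ax (le_lt_trans xc).
Qed.

Lemma ge0_integrable_improper f F a b : a < b ->
  {in `[a, b[, forall x, 0 <= f x} ->
  {in `[a, b[, forall x, {for x, continuous f}} ->
  {in `[a, b[, forall x, is_derive x (1 : R) F (f x)} ->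
  {for b, continuous F} -> 0 <= f b ->
  mu.-integrable `[a, b] (EFin \o f).
Proof.
move=> ab f0 cf dF cF fb; apply/integrableP; split.
  by apply/measurable_EFinP; exact: measurable_fun_continuous_co cf.
suff -> : (\int[mu]_(x in `[a, b]) `|(EFin \o f) x| = (F b - F a)%:E)%E.
  exact: ltry.
rewrite -(ge0_FTC2_improper ab f0 cf dF cF); apply: eq_integral => x.
rewrite inE/= in_itv/= => /andP[ax]; rewrite le_eqVlt => /predU1P[->|xb].
  by rewrite ger0_norm.
by rewrite ger0_norm// f0// in_itv/= ax.
Qed.

End ImproperFTC.

(** * The elliptic integrals *)

Section EllipticIntegrals.
Variable R : realType.
Notation mu := (@lebesgue_measure R).
Implicit Types (t lam nu k : R) (m N : nat).

(** This is [t x^(m - 1/2)] for [x = 1 - t ^+ 2]; at [t = 1] its value is 0, because [0^-1 = 0]. *)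
Definition moment_fun m t := t * (1 - t ^+ 2) ^+ m / Num.sqrt (1 - t ^+ 2).

Lemma one_sub_sqr_gt0 t : 0 <= t -> t < 1 -> 0 < 1 - t ^+ 2.
Proof. by move=> t0 t1; rewrite subr_gt0 expr_lt1. Qed.

Lemma continuous_one_sub_mul_sqr (c : R) :
  continuous (fun t : R => 1 - c * t ^+ 2).
Proof.
move=> t.
apply: (@continuousB R R^o _ (cst 1) (fun t => c * t ^+ 2)).
  exact: cst_continuous.
by apply: continuousM; [exact: cst_continuous|exact: exprn_continuous].
Qed.

Lemma continuous_one_sub_sqr : continuous (fun t : R => 1 - t ^+ 2).
Proof.
under eq_fun do rewrite -[_ ^+ 2]mul1r.
exact: continuous_one_sub_mul_sqr.
Qed.

Lemma continuous_sqrt_comp (f : R -> R) t : {for t, continuous f} ->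
  {for t, continuous (fun t => Num.sqrt (f t))}.
Proof.
move=> cf; apply: (continuous_comp (g := Num.sqrt) cf).
exact: sqrt_continuous.
Qed.

Lemma continuous_moment_fun m t : 0 <= t -> t < 1 ->
  {for t, continuous (moment_fun m)}.
Proof.
move=> t0 t1.
have c := @continuous_one_sub_sqr t.
apply: continuousM.
  apply: continuousM; first exact: cvg_id.
  apply: (continuous_comp (g := fun y : R => y ^+ m) c).
  exact: exprn_continuous.
apply: continuousV; first by rewrite gt_eqF// sqrtr_gt0 one_sub_sqr_gt0.
exact: continuous_sqrt_comp.
Qed.

(** A primitive that stays continuous at [t = 1]; it is the source of the denominators [2m + 1] in
    the expansion. *)
Definition moment_primitive m t :=
  - (Num.sqrt (1 - t ^+ 2) ^+ (2 * m).+1 / (2 * m).+1%:R).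

Lemma is_derive_moment_primitive m t : 0 <= t -> t < 1 ->
  is_derive t (1 : R) (moment_primitive m) (moment_fun m t).
Proof.
move=> t0 t1; have x0 := one_sub_sqr_gt0 t0 t1.
have dx : is_derive t (1:R) (fun t => 1 - t ^+ 2) (- (2 * t)).
  apply: is_derive_eq.
  by rewrite /GRing.scale/=; ring.
have ds := @is_derive1_comp _ Num.sqrt _ t _ _ (is_derive1_sqrt x0) dx.
have -> : moment_primitive m = (- (2 * m).+1%:R^-1) \*:
    (Num.sqrt \o (fun t : R => 1 - t ^+ 2)) ^+ (2 * m).+1.
  by apply/funext => s; rewrite /moment_primitive !fctE mulrC -mulNr.
apply: is_derive_eq.
rewrite /= /GRing.scale/= exprM sqr_sqrtr ?(ltW x0)// /moment_fun.
have s0 : Num.sqrt (1 - t ^+ 2) != 0 by rewrite gt_eqF// sqrtr_gt0.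
have m0 : (2 * m).+1%:R != 0 :> R by rewrite pnatr_eq0.
set p := _.+1%:R in m0 *; field; exact/andP.
Qed.

Lemma continuous_moment_primitive m t :
  {for t, continuous (moment_primitive m)}.
Proof.
have c := @continuous_one_sub_sqr t.
apply: (@continuousN R R^o _
  (fun t => Num.sqrt (1 - t ^+ 2) ^+ (2 * m).+1 / (2 * m).+1%:R)).
apply: continuousM; last exact: cst_continuous.
apply: (continuous_comp (g := fun y : R => y ^+ (2 * m).+1)
  (continuous_sqrt_comp c)); exact: exprn_continuous.
Qed.

Lemma moment_fun_ge0 m t : 0 <= t -> t <= 1 -> 0 <= moment_fun m t.
Proof.
move=> t0 t1; rewrite !mulr_ge0 ?invr_ge0 ?sqrtr_ge0 ?exprn_ge0//.
by rewrite subr_ge0 expr_le1.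
Qed.

Section Moment.
Variable lam : R.
Hypotheses (lam0 : 0 <= lam) (lam1 : lam < 1).

Let itvP t : t \in `[lam, 1[ -> 0 <= t /\ t < 1.
Proof. by rewrite in_itv/= => /andP[/(le_trans lam0)]. Qed.

Lemma integrable_moment_fun m : mu.-integrable `[lam, 1] (EFin \o moment_fun m).
Proof.
apply: (ge0_integrable_improper (F := moment_primitive m)) => //.
- by move=> t /itvP[t0 /ltW t1]; exact: moment_fun_ge0.
- by move=> t /itvP[]; exact: continuous_moment_fun.
- by move=> t /itvP[]; exact: is_derive_moment_primitive.
- exact: continuous_moment_primitive.
- exact: moment_fun_ge0.
Qed.

Lemma integrable_moment_funZ r m :
  mu.-integrable `[lam, 1] (EFin \o (fun t => r * moment_fun m t)).
Proof.
have : mu.-integrable `[lam, 1] (fun t => r%:E * (moment_fun m t)%:E)%E.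
  by apply: integrableZl => //; exact: integrable_moment_fun.
by apply: eq_integrable.
Qed.

Lemma Rintegral_moment_fun m : \int[mu]_(t in `[lam, 1]) moment_fun m t =
  Num.sqrt (1 - lam ^+ 2) * (1 - lam ^+ 2) ^+ m / (2 * m).+1%:R.
Proof.
rewrite /Rintegral (ge0_FTC2_improper (F := moment_primitive m)) //.
- rewrite /moment_primitive expr1n subrr sqrtr0 exprS mul0r mul0r oppr0 sub0r.
  rewrite opprK /= exprS exprM sqr_sqrtr// subr_ge0 expr_le1//; exact: ltW.
- by move=> t /itvP[t0 /ltW t1]; exact: moment_fun_ge0.
- by move=> t /itvP[]; exact: continuous_moment_fun.
- by move=> t /itvP[]; exact: is_derive_moment_primitive.
- exact: continuous_moment_primitive.
Qed.

Lemma integrable_moment_sum (q : nat -> R) N :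
  mu.-integrable `[lam, 1]
    (EFin \o (fun t => \sum_(m < N) q m * moment_fun m t)).
Proof.
elim: N => [|N IH].
  apply: eq_integrable (integrable0 _ _) => //= t _.
  by rewrite big_ord0.
apply: eq_integrable (integrableD _ IH (integrable_moment_funZ (q N) N)) => //.
by move=> t _; rewrite /= big_ord_recr/= EFinD.
Qed.

Lemma Rintegral_moment_sum (q : nat -> R) N :
  \int[mu]_(t in `[lam, 1]) (\sum_(m < N) q m * moment_fun m t) =
  \sum_(m < N) q m *
    (Num.sqrt (1 - lam ^+ 2) * (1 - lam ^+ 2) ^+ m / (2 * m).+1%:R).
Proof.
elim: N => [|N IH].
  rewrite big_ord0; under eq_Rintegral do rewrite big_ord0.
  by rewrite /Rintegral integral0.
rewrite [RHS]big_ord_recr/= -IH -Rintegral_moment_fun.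
rewrite -RintegralZl//; last exact: integrable_moment_fun.
rewrite -RintegralD//.
- by apply: eq_Rintegral => t _; rewrite big_ord_recr.
- exact: integrable_moment_sum.
- exact: integrable_moment_funZ.
Qed.

End Moment.

(** * The integrand of Pi and its form in [x = 1 - t ^+ 2] *)

Definition Pi_integrand nu k t :=
  ((1 + nu * t ^+ 2) * Num.sqrt ((1 - t ^+ 2) * (1 - k ^+ 2 * t ^+ 2)))^-1.

Section Pi_integrand.
Variables nu k : R.
Hypotheses (nu1 : -1 < nu) (k0 : 0 <= k) (k1 : k < 1).

Lemma Pi_characteristic_gt0 t : 0 <= t -> t <= 1 -> 0 < 1 + nu * t ^+ 2.
Proof.
move=> t0 t1; have : t ^+ 2 <= 1 by rewrite expr_le1.
have := sqr_ge0 t; rewrite le_eqVlt => /predU1P[<-|s0] s1.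
  by rewrite mulr0 addr0.
have : 0 < (nu + 1) * t ^+ 2 by rewrite mulr_gt0// -ltrBlDr sub0r.
by nra.
Qed.

Lemma Pi_modulus_gt0 t : 0 <= t -> t <= 1 -> 0 < 1 - k ^+ 2 * t ^+ 2.
Proof.
move=> t0 t1; have : t ^+ 2 <= 1 by rewrite expr_le1.
have : k ^+ 2 < 1 by rewrite expr_lt1.
by rewrite subr_gt0 => k21 t21; rewrite (le_lt_trans _ k21)// ler_piMr ?sqr_ge0.
Qed.

Lemma Pi_integrand_ge0 t : 0 <= t -> t <= 1 -> 0 <= Pi_integrand nu k t.
Proof.
move=> t0 t1; rewrite invr_ge0 mulr_ge0 ?sqrtr_ge0//.
by rewrite ltW ?Pi_characteristic_gt0.
Qed.

Lemma continuous_Pi_integrand t : 0 <= t -> t < 1 ->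
  {for t, continuous (Pi_integrand nu k)}.
Proof.
move=> t0 t1; have t1' := ltW t1; apply: continuousV.
  rewrite mulf_neq0 ?gt_eqF ?Pi_characteristic_gt0// sqrtr_gt0.
  by rewrite mulr_gt0 ?one_sub_sqr_gt0 ?Pi_modulus_gt0.
apply: continuousM.
  have -> : (fun t : R => 1 + nu * t ^+ 2) = (fun t => 1 - (- nu) * t ^+ 2).
    by apply/funext => s; rewrite mulNr opprK.
  exact: continuous_one_sub_mul_sqr.
apply: continuous_sqrt_comp; apply: continuousM.
  exact: continuous_one_sub_sqr.
exact: continuous_one_sub_mul_sqr.
Qed.

(** The real integral is the [fine] of an extended one, so additivity needs finite pieces:
    continuity provides this on [[0, lam]], the premise on [[lam, 1]]. *)
Lemma completePi_split lam : 0 <= lam -> lam < 1 ->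
  mu.-integrable `[lam, 1] (EFin \o Pi_integrand nu k) ->
  completePi nu k =
  ellipticPi lam nu k + \int[mu]_(t in `[lam, 1]) Pi_integrand nu k t.
Proof.
move=> lam0 lam1 int1.
have mW : measurable_fun (`[0, 1] : set R) (EFin \o Pi_integrand nu k).
  apply/measurable_EFinP; apply: measurable_fun_continuous_co => t.
  by rewrite in_itv/= => /andP[]; exact: continuous_Pi_integrand.
have int0 : mu.-integrable `[0, lam] (EFin \o Pi_integrand nu k).
  apply: continuous_compact_integrable; first exact: segment_compact.
  apply: continuous_in_subspaceT => t; rewrite inE/= in_itv/= => /andP[t0 tl].
  by apply: continuous_Pi_integrand => //; exact: le_lt_trans lam1.
have int1' : mu.-integrable `]lam, 1] (EFin \o Pi_integrand nu k).
  by apply: integrableS int1 => //; exact: subset_itv_oc_cc.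
rewrite -Rintegral_itv_obnd_cbnd// /completePi /ellipticPi /Rintegral.
rewrite -fineD; last 2 first.
- exact: integrable_fin_num int0.
- exact: integrable_fin_num int1'.
rewrite -ge0_integral_setU//=.
- by rewrite -itv_bndbnd_setU// bnd_simp// ltW.
- by rewrite -itv_bndbnd_setU// bnd_simp// ltW.
- move=> t; rewrite !in_itv/= lee_fin.
  by move=> [] /andP[? ?]; apply: Pi_integrand_ge0; lra.
- apply/disj_setPS => t [/=]; rewrite !in_itv/= => /andP[_ tl] /andP[].
  by rewrite ltNge tl.
Qed.

Local Notation a := (nu / (1 + nu)).
Local Notation b := (k ^+ 2 / (1 - k ^+ 2)).
Local Notation K := ((1 + nu) * Num.sqrt (1 - k ^+ 2))^-1.

(** The substitution is carried out pointwise, so no change of variables in the integral occurs.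
    Positivity of [t] lets [sqrt (1 - x) = t] cancel the factor [t] of [moment_fun]; at [t = 1] both
    sides are 0. *)
Lemma Pi_integrandE t : 0 < t -> t <= 1 ->
  Pi_integrand nu k t = K * (moment_fun 0 t * integrand a b (1 - t ^+ 2)).
Proof.
move=> t0 t1; have t2 : 0 < t ^+ 2 by rewrite exprn_gt0.
have nu0 : 0 < 1 + nu by rewrite addrC -ltrBlDr sub0r.
have k2 : 0 < 1 - k ^+ 2 by rewrite subr_gt0 expr_lt1.
have c0 := Pi_characteristic_gt0 (ltW t0) t1.
have m0 := Pi_modulus_gt0 (ltW t0) t1.
rewrite /integrand /moment_fun /Pi_integrand expr0 mulr1.
have -> : 1 - a * (1 - t ^+ 2) = (1 + nu * t ^+ 2) / (1 + nu).
  by field; rewrite gt_eqF.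
have -> : 1 + b * (1 - t ^+ 2) = (1 - k ^+ 2 * t ^+ 2) / (1 - k ^+ 2).
  by field; rewrite gt_eqF.
rewrite opprB addrCA subrr addr0 sqrtr_sqr (gtr0_norm t0).
rewrite sqrtrM ?subr_ge0 ?expr_le1 ?(ltW t0)//.
rewrite sqrtrM ?(ltW m0)// sqrtrV ?(ltW k2)//.
have sk : Num.sqrt (1 - k ^+ 2) != 0 by rewrite gt_eqF// sqrtr_gt0.
have sm : Num.sqrt (1 - k ^+ 2 * t ^+ 2) != 0 by rewrite gt_eqF// sqrtr_gt0.
have [->|st] := eqVneq (Num.sqrt (1 - t ^+ 2)) 0.
  by rewrite !(mul0r, mulr0, invr0).
field; rewrite sk sm st !gt_eqF//.
Qed.

Section Remainder.
Variable lam : R.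
Hypotheses (lam0 : 0 < lam) (lam1 : lam < 1).
Local Notation x0 := (1 - lam ^+ 2).

Let K0 : 0 <= K.
Proof.
by rewrite invr_ge0 mulr_ge0 ?sqrtr_ge0// addrC -lerBlDr sub0r ltW.
Qed.

(** The bound [c0] makes the integrand integrable by comparison with [K * c0 * moment_fun 0]. The
    tail bound turns [moment_fun 0] into [c * moment_fun N], whose integral is explicit. *)
Lemma remainder_bound N c0 c (Q := integrand_coef a b) :
  (forall x, 0 <= x -> x <= x0 -> `|integrand a b x| <= c0) ->
  (forall x, 0 <= x -> x <= x0 ->
    `|integrand a b x - \sum_(m < N) Q m * x ^+ m| <= c * x ^+ N) ->
  `|completePi nu k - ellipticPi lam nu k - K * Num.sqrt x0 *
     \sum_(m < N) x0 ^+ m / (2 * m).+1%:R * Q m| <=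
  K * Num.sqrt x0 * c * x0 ^+ N / (2 * N).+1%:R.
Proof.
move=> bound tail.
have itvP t : `[lam, 1]%classic t -> [/\ 0 < t, t <= 1, 0 <= 1 - t ^+ 2 &
    1 - t ^+ 2 <= x0].
  rewrite /= in_itv/= => /andP[lt t1]; have t0 := lt_le_trans lam0 lt.
  split => //; first by rewrite subr_ge0 expr_le1// ltW.
  by rewrite lerD2l lerN2 lerXn2r// nnegrE ltW.
have intW : mu.-integrable `[lam, 1] (EFin \o Pi_integrand nu k).
  have := integrable_moment_funZ (ltW lam0) lam1 (K * c0) 0.
  apply: le_integrable => //.
    apply/measurable_EFinP; apply: measurable_fun_continuous_co => t.
    rewrite in_itv/= => /andP[lt]; apply: continuous_Pi_integrand.
    by rewrite (le_trans _ lt)// ltW.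
  move=> t /itvP[t0 t1 x_ge0 xx0]; rewrite /= lee_fin Pi_integrandE//.
  rewrite normrM -[K * c0 * _]mulrA [leRHS]normrM ler_wpM2l//.
  rewrite [leLHS]normrM [leRHS]normrM mulrC ler_wpM2r//.
  by rewrite (le_trans (bound _ x_ge0 xx0))// ler_norm.
rewrite (completePi_split (ltW lam0) lam1 intW) [X in X - _ - _]addrC addrK.
have -> : K * Num.sqrt x0 * (\sum_(m < N) x0 ^+ m / (2 * m).+1%:R * Q m) =
    \int[mu]_(t in `[lam, 1]) \sum_(m < N) K * Q m * moment_fun m t.
  rewrite (Rintegral_moment_sum (ltW lam0) lam1 (fun m => K * Q m)).
  by rewrite mulr_sumr; apply: eq_bigr => m _; ring.
have intS := integrable_moment_sum (ltW lam0) lam1 (fun m => K * Q m) N.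
rewrite -RintegralB//.
apply: le_trans (le_normr_Rintegral _ _) _ => //.
  exact: integrableB intW intS.
apply: (@le_trans _ _
  (\int[mu]_(t in `[lam, 1]) (K * c * moment_fun N t))); last first.
  rewrite RintegralZl// ?Rintegral_moment_fun ?(ltW lam0)//.
    by rewrite le_eqVlt; apply/orP; left; apply/eqP; ring.
  by apply: integrable_moment_fun => //; exact: ltW.
apply: le_Rintegral => //.
- apply: integrable_norm; exact: integrableB intW intS.
- exact: integrable_moment_funZ (ltW lam0) lam1 _ _.
move=> t /itvP[t0 t1 x_ge0 xx0].
have -> : Pi_integrand nu k t - \sum_(m < N) K * Q m * moment_fun m t =
    K * moment_fun 0 t * (integrand a b (1 - t ^+ 2) -
      \sum_(m < N) Q m * (1 - t ^+ 2) ^+ m).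
  rewrite Pi_integrandE// mulrBr mulrA; congr (_ - _).
  by rewrite mulr_sumr; apply: eq_bigr => m _; rewrite /moment_fun; ring.
have s0 := moment_fun_ge0 0 (ltW t0) t1.
rewrite normrM (ger0_norm (mulr_ge0 K0 s0)).
apply: le_trans (ler_wpM2l (mulr_ge0 K0 s0) (tail _ x_ge0 xx0)) _.
rewrite le_eqVlt; apply/orP; left; apply/eqP; rewrite /moment_fun; ring.
Qed.

End Remainder.

End Pi_integrand.

End EllipticIntegrals.

(** * Matching the constants of the five cases *)

Section Cases.
Variable R : realType.
Implicit Types (k lam nu x : R).

Lemma powR_half x N : 0 <= x -> x `^ (N%:R + 2^-1) = x ^+ N * Num.sqrt x.
Proof.
move=> x0; rewrite powRD ?powR_mulrn ?powR12_sqrt//.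
by rewrite [_ + _ == 0]gt_eqF// ltr_wpDl.
Qed.

Lemma inv_mul_le_split p q r : 0 < p -> 0 < q -> 0 < r -> r <= p + q ->
  p^-1 / q <= r^-1 * (p^-1 + q^-1) :> R.
Proof.
move=> p0 q0 r0 rpq; rewrite ler_pdivlMl//.
have -> : p^-1 + q^-1 = (p + q) * (p^-1 / q).
  by field; rewrite !gt_eqF.
by rewrite ler_wpM2r// mulr_ge0// invr_ge0 ltW.
Qed.

(** At [z = 1 / (1 - k^2)] one has [1 - z = - b], so [hyp2F1_half] produces [isqrt2_coef b n]; the
    surplus factor [1 / (1 + nu)] becomes part of [K]. *)
Lemma hyp_sumE nu k m : -1 < nu -> 0 <= k -> k < 1 ->
  \sum_(n < m.+1)
     nu ^+ (m - n) * hyp2F1 (- n%:R) (2^-1) 1 ((1 - k ^+ 2)^-1)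
     / (1 + nu) ^+ (m - n + 1) =
  (1 + nu)^-1 * integrand_coef (nu / (1 + nu)) (k ^+ 2 / (1 - k ^+ 2)) m.
Proof.
move=> nu1 k0 k1; rewrite mulr_sumr; apply: eq_bigr => n _.
have nu0 : 1 + nu != 0 by rewrite gt_eqF// addrC -ltrBlDr sub0r.
have k2 : 1 - k ^+ 2 != 0 by rewrite gt_eqF// subr_gt0 expr_lt1.
rewrite hyp2F1_half (_ : 1 - (1 - k ^+ 2)^-1 = - (k ^+ 2 / (1 - k ^+ 2))).
  rewrite -/(isqrt2_coef _ n) expr_div_n addn1.
  by rewrite [(1 + nu) ^+ _.+1]exprS invfM; ring.
by field.
Qed.

End Cases.

Theorem theorem2 (R : realType) (k lam nu : R) (N : nat)
    (hk0 : 0 <= k) (hk1 : k < 1) (hlam0 : 0 <= lam) (hlam1 : lam <= 1)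
    (hregion : (1 - lam ^+ 2) * k ^+ 2 / (1 - k ^+ 2) < 1)
    (hnu : -1 < nu)
    (hnulam : (1 - lam ^+ 2) * `|nu| / (nu + 1) < 1)
    (hN : (0 < N)%N) :
  exists R2N : R,
    ellipticPi lam nu k =
      completePi nu k
      - Num.sqrt ((1 - lam ^+ 2) / (1 - k ^+ 2)) *
        (\sum_(m < N) (1 - lam ^+ 2) ^+ m / (2 * m + 1)%:R *
           \sum_(n < m.+1)
             nu ^+ (m - n) * hyp2F1 (- n%:R) (2^-1) 1 ((1 - k ^+ 2)^-1)
             / (1 + nu) ^+ (m - n + 1))
      + R2N
    /\
    let bounded_with f :=
      `|R2N| <=
        (1 - lam ^+ 2) `^ (N%:R + 2^-1) / (2 * N + 1)%:R *
        (Num.max (Num.max (k ^+ 2 / (1 - k ^+ 2)) (`|nu| / (nu + 1))) 1)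
          `^ (N%:R + 2^-1) * f in
    [/\ (* (1) *)
        (1 < k ^+ 2 / (1 - k ^+ 2) ->
         `|nu| / (nu + 1) < k ^+ 2 / (1 - k ^+ 2) ->
         bounded_with
           (((1 + nu) * k)^-1
            * (1 - (1 - lam ^+ 2) * k ^+ 2 / (1 - k ^+ 2))^-1
            * (1 - `|nu| * (1 - k ^+ 2) / ((nu + 1) * k ^+ 2))^-1)),
        (* (2) *)
        (k ^+ 2 / (1 - k ^+ 2) < `|nu| / (nu + 1) ->
         1 < k ^+ 2 / (1 - k ^+ 2) ->
         bounded_with
           ((Num.sqrt ((1 - k ^+ 2) * (1 + nu) * `|nu|))^-1
            * (1 - (1 - lam ^+ 2) * `|nu| / (1 + nu))^-1
            * (1 - (nu + 1) * k ^+ 2 / (`|nu| * (1 - k ^+ 2)))^-1)),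
        (* (3): here the hypotheses force 0 < lam *)
        (1 < `|nu| / (nu + 1) ->
         k ^+ 2 / (1 - k ^+ 2) <= 1 ->
         bounded_with
           ((Num.sqrt ((1 - k ^+ 2) * (1 + nu) * `|nu|))^-1
            * (1 - (1 - lam ^+ 2) * `|nu| / (1 + nu))^-1
            * ((1 - (1 + nu) / `|nu|)^-1 + (lam ^+ 2)^-1))),
        (* (4): for lam = 0 the bound is +oo, i.e. vacuous *)
        (k ^+ 2 / (1 - k ^+ 2) <= 1 ->
         `|nu| / (nu + 1) < 1 ->
         lam != 0 ->
         bounded_with
           (((1 + nu) * Num.sqrt (1 - k ^+ 2))^-1
            * (1 - (1 - lam ^+ 2) * `|nu| / (1 + nu))^-1
            * ((1 - `|nu| / (1 + nu))^-1 + (lam ^+ 2)^-1))) &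
        (* (5) *)
        (Num.max (k ^+ 2 / (1 - k ^+ 2)) 1 = `|nu| / (nu + 1) ->
         bounded_with
           ((Num.sqrt ((1 - k ^+ 2) * (1 + nu) * `|nu|))^-1
            * (1 - (1 - lam ^+ 2) * `|nu| / (1 + nu))^-1
            * ((1 - (1 - lam ^+ 2) * `|nu| / (1 + nu))^-1 + N%:R)))].
Proof.
(* The remainder is the expansion solved for it, so the identity is immediate and only the bounds
   remain. *)
set S := Num.sqrt _ * _; exists (ellipticPi lam nu k - completePi nu k + S).
split; first by ring.
rewrite (addrC nu 1) in hnulam *.
set x0 := 1 - lam ^+ 2 in hregion hnulam S *.
set A := `|nu| / (1 + nu); set b := k ^+ 2 / (1 - k ^+ 2).
pose C := Num.max 1 b.
have nu0 : 0 < 1 + nu by rewrite addrC -ltrBlDr sub0r.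
have k2 : 0 < 1 - k ^+ 2 by rewrite subr_gt0 expr_lt1.
have A0 : 0 <= A by rewrite divr_ge0// ltW.
have b0 : 0 <= b by rewrite divr_ge0 ?sqr_ge0// ltW.
have x0_ge0 : 0 <= x0 by rewrite subr_ge0 expr_le1.
have bx0 : b * x0 < 1 by rewrite mulrC mulrA.
have Ax0 : A * x0 < 1 by rewrite mulrC mulrA.
set K := ((1 + nu) * Num.sqrt (1 - k ^+ 2))^-1.
have K0 : 0 <= K by rewrite invr_ge0 mulr_ge0 ?sqrtr_ge0// ltW.
have normA : `|nu / (1 + nu)| = A by rewrite normf_div (gtr0_norm nu0).
pose Q := integrand_coef (nu / (1 + nu)) b.
have SE : S = K * Num.sqrt x0 *
    \sum_(m < N) x0 ^+ m / (2 * m).+1%:R * Q m.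
  rewrite /S sqrtrM// sqrtrV ?(ltW k2)// !mulr_sumr.
  by apply: eq_bigr => m _; rewrite hyp_sumE// addn1 /K /Q invfM; ring.
have -> : Num.max (Num.max b A) 1 = Num.max A C.
  by rewrite /C maxAC maxC [Num.max b 1]maxC.
move=> bounded_with.
have C1 : 1 <= C by rewrite le_max lexx.
set D := Num.max A C in bounded_with *.
have C0 : 0 <= C by rewrite (le_trans ler01).
have D1 : 1 <= D by rewrite le_max C1 orbT.
have D0 : 0 <= D by rewrite (le_trans ler01).
(* At [lam = 0] one has [x0 = 1], and the region hypotheses would read [b < 1] and [A < 1]. *)
have lam_gt0 : 1 <= A \/ 1 < b -> 0 < lam.
  move=> H; rewrite lt_neqAle hlam0 andbT; apply/eqP => l0.
  by move: bx0 Ax0; rewrite /x0 -l0 expr0n subr0 !mulr1; case: H; lra.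
have coefQ m : `|Q m| <= \sum_(n < m.+1) C ^+ n * A ^+ (m - n).
  by rewrite -normA; exact: integrand_coef_le.
have coefD m : `|Q m| <= m.+1%:R * D ^+ m.
  apply: le_trans (coefQ m) _; rewrite -[X in X%:R](card_ord m.+1) mulr_natl.
  rewrite -sumr_const; apply: ler_sum => n _; rewrite [leRHS](expr_split D n).
  by rewrite ler_pM ?exprn_ge0// lerXn2r// ?nnegrE// /D le_max lexx ?orbT.
have CDx0 : D * x0 < 1 -> Num.max 1 b * x0 < 1.
  by apply: le_lt_trans; rewrite ler_wpM2r// le_max lexx orbT.
have ADx0 : D * x0 < 1 -> `|nu / (1 + nu)| * x0 < 1.
  by apply: le_lt_trans; rewrite ler_wpM2r// normA le_max lexx.
have Dx0 : 0 < lam -> D * x0 < 1.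
  move=> lam_pos; have x01 : x0 < 1 by rewrite gtrBl exprn_gt0.
  by rewrite /D /C !maxr_pMl// !gt_max mul1r Ax0 x01.
(* Common reduction: a uniform tail constant [c] yields the bound with [f] once [K * c] is at most
   [D^(N + 1/2) f]. For [lam = 1] both remainder and bound vanish. *)
have from_tail f c : 0 < lam -> (forall x, 0 <= x -> x <= x0 ->
      `|integrand (nu / (1 + nu)) b x - \sum_(m < N) Q m * x ^+ m| <=
      c * x ^+ N) ->
    K * c <= D ^+ N * Num.sqrt D * f -> bounded_with f.
  move=> lam_pos tail Kc; rewrite /bounded_with !powR_half//.
  have [lam1|lam_neq1] := eqVneq lam 1.
    have x00 : x0 = 0 by rewrite /x0 lam1 expr1n subrr.
    rewrite SE x00 sqrtr0 !(mulr0, mul0r) addr0 /completePi lam1 subrr.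
    by rewrite normr0.
  have lam_lt1 : lam < 1 by rewrite lt_neqAle lam_neq1.
  (* The tail estimate at [N = 0], whose partial sum is empty, bounds the integrand itself. *)
  have bound x : 0 <= x -> x <= x0 ->
      `|integrand (nu / (1 + nu)) b x| <= (1 - D * x0)^-1 * (1 - D * x0)^-1.
    move=> x_ge0 xx0.
    have := integrand_arith_geometric_tail b0 (CDx0 (Dx0 lam_pos))
      (ADx0 (Dx0 lam_pos)) x_ge0 xx0 0 D0 (Dx0 lam_pos) coefD.
    by rewrite big_ord0 subr0 !expr0 addr0 mul1r mulr1.
  have := remainder_bound hnu hk0 hk1 lam_pos lam_lt1 bound tail.
  rewrite -SE -normrN !opprD !opprK addrC [_ + ellipticPi _ _ _]addrC -/x0.
  rewrite [S + _]addrC => /le_trans; apply; rewrite addn1.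
  rewrite [leLHS](_ : _ = x0 ^+ N * Num.sqrt x0 / (2 * N).+1%:R * (K * c)).
    by rewrite -[leRHS]mulrA ler_wpM2l// !mulr_ge0 ?exprn_ge0 ?sqrtr_ge0.
  by rewrite /K /x0; ring.
(* When [A != C], the mixed geometric sum supplies the constant; [D ^+ N] cancels and leaves an
   inequality free of [N]. *)
have from_geometric f : 0 < lam -> A != C ->
    K / (1 - Num.min A C / D) / (1 - D * x0) <= Num.sqrt D * f ->
    bounded_with f.
  move=> lam_pos AC Kf.
  have D_gt0 : 0 < D by rewrite (lt_le_trans ltr01).
  have B0 : 0 <= (1 - Num.min A C / D)^-1.
    by rewrite invr_ge0 subr_ge0 ler_pdivrMr// mul1r ge_min le_max lexx.
  apply: (from_tail _ ((1 - Num.min A C / D)^-1 * D ^+ N / (1 - D * x0))) => //.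
    move=> x x_ge0 xx0; apply: (integrand_geometric_tail b0 (CDx0 (Dx0 lam_pos))
      (ADx0 (Dx0 lam_pos)) x_ge0 xx0 N B0 D0 (Dx0 lam_pos)) => m.
    apply: le_trans (coefQ m) _; rewrite mulrC.
    by apply: mixed_geometric_le => //; rewrite (le_trans ler01).
  rewrite -[leRHS]mulrA mulrA mulrA [K * _]mulrC -!mulrA [leLHS]mulrCA.
  by rewrite ler_wpM2l ?exprn_ge0//; apply: le_trans Kf; rewrite mulrCA mulrA.
have facb : x0 * k ^+ 2 / (1 - k ^+ 2) = b * x0 by rewrite -mulrA mulrC.
have facA : x0 * `|nu| / (1 + nu) = A * x0 by rewrite -mulrA mulrC.
have sq0 : 0 < Num.sqrt (1 - k ^+ 2) by rewrite sqrtr_gt0.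
have sp0 : 0 < Num.sqrt (1 + nu) by rewrite sqrtr_gt0.
have nu_neq0 : 0 < A -> `|nu| != 0.
  by apply: contraTneq => nu00; rewrite /A nu00 mul0r ltxx.
(* The prefactors of [f] are [K / sqrt D]: this identity covers [D = A], and [sqrtb] covers
   [D = b]. *)
have sqrtA : 0 < A ->
    Num.sqrt A * (Num.sqrt ((1 - k ^+ 2) * (1 + nu) * `|nu|))^-1 = K.
  move=> A_gt0; have nuN : 0 < `|nu|.
    by rewrite lt_neqAle eq_sym normr_ge0 nu_neq0.
  have sn0 : 0 < Num.sqrt `|nu| by rewrite sqrtr_gt0.
  rewrite /A /K -[in RHS](sqr_sqrtr (ltW nu0)).
  rewrite (sqrtrM _ (normr_ge0 _)) (sqrtrV (ltW nu0)).
  rewrite sqrtrM ?mulr_ge0 ?(ltW k2) ?(ltW nu0)// sqrtrM ?(ltW k2)//.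
  by field; rewrite !gt_eqF.
have sqrtb : 0 < k -> Num.sqrt b * ((1 + nu) * k)^-1 = K.
  move=> k_gt0; rewrite /b sqrtrM ?sqr_ge0// sqrtr_sqr (gtr0_norm k_gt0).
  rewrite (sqrtrV (ltW k2)) /K.
  by field; rewrite !gt_eqF.
rewrite facb facA.
split.
- move=> b1 Ab; have lam_pos := lam_gt0 (or_intror b1).
  have CE : C = b by rewrite /C max_r// ltW.
  have DE : D = b by rewrite /D CE max_r// ltW.
  have k_gt0 : 0 < k.
    rewrite lt_neqAle eq_sym hk0 andbT; apply: contraTneq b1 => k00.
    by rewrite /b k00 expr0n mul0r ltr10.
  apply: from_geometric; rewrite ?CE ?lt_eqF// DE min_l ?(ltW Ab)//.
  have -> : `|nu| * (1 - k ^+ 2) / ((1 + nu) * k ^+ 2) = A / b.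
    by rewrite /A /b; field; rewrite !gt_eqF// exprn_gt0.
  by rewrite !mulrA sqrtb// mulrAC.
- move=> bA b1; have lam_pos := lam_gt0 (or_intror b1).
  have CE : C = b by rewrite /C max_r// ltW.
  have DE : D = A by rewrite /D CE max_l// ltW.
  have A_gt0 : 0 < A by exact: le_lt_trans bA.
  apply: from_geometric; rewrite ?CE ?gt_eqF// DE min_r ?(ltW bA)//.
  have -> : (1 + nu) * k ^+ 2 / (`|nu| * (1 - k ^+ 2)) = b / A.
    rewrite /A /b invf_div; field.
    by rewrite nu_neq0// gt_eqF.
  by rewrite !mulrA sqrtA// mulrAC.
- move=> A1 b1; have lam_pos := lam_gt0 (or_introl (ltW A1)).
  have CE : C = 1 by rewrite /C max_l.
  have DE : D = A by rewrite /D CE max_l// ltW.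
  have A_gt0 : 0 < A by exact: le_lt_trans A1.
  apply: from_geometric; rewrite ?CE ?gt_eqF// DE min_r ?(ltW A1)//.
  have -> : (1 + nu) / `|nu| = 1 / A by rewrite /A invf_div mul1r.
  (* The geometric constant is the first summand; adding the nonnegative [1 / lam^2] enlarges it. *)
  rewrite !mulrA sqrtA// mulrAC ler_wpM2l ?lerDl ?invr_ge0 ?sqr_ge0//.
  by rewrite mulr_ge0// invr_ge0 subr_ge0 ltW.
- move=> b1 A1 lam_neq0.
  have lam_pos : 0 < lam by rewrite lt_neqAle eq_sym lam_neq0.
  have CE : C = 1 by rewrite /C max_l.
  have DE : D = 1 by rewrite /D CE max_r// ltW.
  apply: from_geometric; rewrite ?CE ?lt_eqF// DE min_l ?(ltW A1)//.
  rewrite sqrtr1 !mul1r divr1 -/K.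
  have q0 : 0 < 1 - x0 by rewrite /x0 opprB addrC subrK exprn_gt0.
  have -> : lam ^+ 2 = 1 - x0 by rewrite /x0 opprB addrC subrK.
  have p0 : 0 < 1 - A by rewrite subr_gt0.
  have r0 : 0 < 1 - A * x0 by rewrite subr_gt0.
  (* The condition [1 - A x0 <= (1 - A) + (1 - x0)] left by the splitting is
     [(1 - A) (1 - x0) >= 0]. *)
  rewrite -[leLHS]mulrA -[leRHS]mulrA ler_wpM2l// inv_mul_le_split//.
  by nra.
- move=> CA.
  have CE : C = A by rewrite /C maxC.
  have lam_pos : 0 < lam by apply: lam_gt0; left; rewrite -CE.
  have DE : D = A by rewrite /D CE maxxx.
  have A_gt0 : 0 < A by rewrite -CE (lt_le_trans ltr01).
  have ADx := Dx0 lam_pos.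
  (* Here [A = C], so the ratios coincide and [coefD], with its factor [m + 1], replaces the
     geometric bound; this is where the summand [N] comes from. *)
  pose c := D ^+ N / (1 - D * x0) * ((1 - D * x0)^-1 + N%:R).
  apply: (from_tail _ c) => //.
    move=> x x_ge0 xx0.
    exact: (integrand_arith_geometric_tail b0 (CDx0 ADx) (ADx0 ADx) x_ge0 xx0 N
      D0 ADx coefD).
  by rewrite /c DE -(sqrtA A_gt0) le_eqVlt; apply/orP; left; apply/eqP; ring.
Qed.
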